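(* Let $G(u)=H(P_\Omega(Q(u)))$ be as described in the context, with Lipschitz constants $c_Q,c_H$, contraction factor $c=c_Hc_Q<1$, and fixed point $u^*$; let $F(u)=G(u)-u$. Suppose that $\bar c:=\frac{2c-c^2}{1-c}<1$. Then for every $\hat c\in(\bar c,1)$ there exists $\delta_0>0$ such that for every $u_0\in D$ with $\|u_0-u^*\|\le\delta_0$, any sequence $\{u_k\}$ generated by Anderson(1) from $u_0$ converges to $u^*$ q-linearly with factor $\hat c$ in the sense that $$\|F(u_{k+1})\|\le \hat c\,\|F(u_k)\|,\qquad k=0,1,2,\ldots.$$
   Context: $\|\cdot\|$ is the Euclidean norm (and the induced operator norm). $\Omega=\{w\in\mathbb{R}^l:\underline w\le w\le\overline w\}$ (componentwise) with $\underline w\in(\{-\infty\}\cup\mathbb{R})^l$, $\overline w\in(\mathbb{R}\cup\{\infty\})^l$, $\underline w<\overline w$ componentwise, and $P_\Omega$ is the Euclidean projection onto $\Omega$. $Q:\mathbb{R}^n\to\mathbb{R}^l$, $H:\mathbb{R}^l\to\mathbb{R}^n$, and $G(u):=H(P_\Omega(Q(u)))$. $D\subset\mathbb{R}^n$ is a closed set with $G(D)\subseteq D$. Standing assumptions: (i) $Q$ is continuously differentiable on $D$ with Lipschitz continuous derivative, and $Q$ is Lipschitz continuous on $D$ with constant $c_Q$; (ii) $H$ is continuously differentiable with Lipschitz continuous derivative on an open set $D_H\supseteq\Omega$, and $H$ is Lipschitz continuous on $D_H$ with constant $c_H$; (iii) $c:=c_Hc_Q<1$. Thus $G$ is a contraction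 on $D$ with factor $c$ and has a unique fixed point $u^*\in D$. It is assumed that there is $\delta>0$ such that the ball $\mathcal{B}(\delta,u^* )=\{u:\|u-u^*\|\le\delta\}$ is contained in $D$. Anderson(1): given $u_0\in D$, set $u_1=G(u_0)$; for $k=1,2,\ldots$, with $F_k=F(u_k)=G(u_k)-u_k$, let $\alpha_k$ be a minimizer over $\alpha\in\mathbb{R}$ of $\|(1-\alpha)F_k+\alpha F_{k-1}\|$ (so $\alpha_k=F_k^{\rm T}(F_k-F_{k-1})/\|F_k-F_{k-1}\|^2$ if $F_k\ne F_{k-1}$), and set $u_{k+1}=(1-\alpha_k)G(u_k)+\alpha_kG(u_{k-1})$. *)

(* Defs.v *)
From HB Require Import structures.
From mathcomp Require Import all_boot all_order all_algebra.
From mathcomp Require Import all_classical all_reals all_analysis.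

Set Implicit Arguments.
Unset Strict Implicit.
Unset Printing Implicit Defensive.

Import Order.TTheory GRing.Theory Num.Theory.
Import numFieldNormedType.Exports.

Local Open Scope classical_set_scope.
Local Open Scope ring_scope.

(* Vectors of R^n are row vectors, so that derivatives are given by the
   library's [jacobian], which acts by v |-> v *m jacobian f x.  The library
   norm on matrices is the sup norm, hence the Euclidean norm below; the
   topology is the same. *)
Definition enorm (R : realType) (n : nat) (v : 'rV[R]_n) : R :=
  Num.sqrt (\sum_(i < n) v ord0 i ^+ 2).

Definition eopnorm (R : realType) (m n : nat) (A : 'M[R]_(m, n)) : R :=
  sup [set enorm (v *m A) | v in [set v : 'rV[R]_m | enorm v <= 1]].

(* Nonnegativity of k only matters when A has at most one point. *)
Definition elipschitz_on (R : realType) (m n : nat) (k : R)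
    (A : set 'rV[R]_m) (f : 'rV[R]_m -> 'rV[R]_n) : Prop :=
  0 <= k /\
  forall x y, A x -> A y -> enorm (f x - f y) <= k * enorm (x - y).

Definition C1_lipschitz_on (R : realType) (m n : nat)
    (A : set 'rV[R]_m) (f : 'rV[R]_m -> 'rV[R]_n) : Prop :=
  [/\ forall x, A x -> differentiable f x,
      {within A, continuous (jacobian f)} &
      exists L : R, forall x y, A x -> A y ->
        eopnorm (jacobian f x - jacobian f y) <= L * enorm (x - y)].

(* Bounds are extended reals; when lo i < hi i for all i, necessarily
   lo i != +oo and hi i != -oo. *)
Definition box (R : realType) (l : nat) (lo hi : 'I_l -> \bar R) :
    set 'rV[R]_l :=
  [set w | forall i, (lo i <= (w ord0 i)%:E)%E /\ ((w ord0 i)%:E <= hi i)%E].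

Definition nearest_point (R : realType) (l : nat) (A : set 'rV[R]_l)
    (w p : 'rV[R]_l) : Prop :=
  A p /\ forall v, A v -> enorm (w - p) <= enorm (w - v).

(* The default value 0 is irrelevant when A is nonempty, closed and convex,
   since the nearest point then exists and is unique. *)
Definition eproj (R : realType) (l : nat) (A : set 'rV[R]_l)
    (w : 'rV[R]_l) : 'rV[R]_l :=
  xget 0 (nearest_point A w).

Definition fixmap (R : realType) (n l : nat) (lo hi : 'I_l -> \bar R)
    (Q : 'rV[R]_n -> 'rV[R]_l) (H : 'rV[R]_l -> 'rV[R]_n)
    (u : 'rV[R]_n) : 'rV[R]_n :=
  H (eproj (box lo hi) (Q u)).

Definition residual (R : realType) (n : nat) (G : 'rV[R]_n -> 'rV[R]_n)
    (u : 'rV[R]_n) : 'rV[R]_n := G u - u.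

(* The step from u_(k+1) and u_k to u_(k+2).  If the two residuals coincide,
   every coefficient is a minimizer and all choices are allowed. *)
Definition anderson1 (R : realType) (n : nat) (G : 'rV[R]_n -> 'rV[R]_n)
    (u0 : 'rV[R]_n) (u : nat -> 'rV[R]_n) : Prop :=
  [/\ u 0%N = u0,
      u 1%N = G u0 &
      forall k : nat, exists alpha : R,
        (forall beta : R,
           enorm ((1 - alpha) *: residual G (u k.+1)
                  + alpha *: residual G (u k))
           <= enorm ((1 - beta) *: residual G (u k.+1)
                     + beta *: residual G (u k)))
        /\ u k.+2 = (1 - alpha) *: G (u k.+1) + alpha *: G (u k)].

(* Main.v *)
Require Import Defs.
From HB Require Import structures.
From mathcomp Require Import all_boot all_order all_algebra.
From mathcomp Require Import all_classical all_reals all_analysis.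
From mathcomp Require Import ring lra.
Import Order.TTheory GRing.Theory Num.Theory.
Import numFieldNormedType.Exports.
Local Open Scope classical_set_scope.
Local Open Scope ring_scope.

(** Write F(u) = G(u) - u, x = u_k, y = u_(k-1) and z = (1 - a) x + a y with the
    minimizing coefficient a, so that the next iterate is
    u_(k+1) = z + ((1 - a) F(x) + a F(y)).  Then
      F(u_(k+1)) = [G(u_(k+1)) - G(z)] + [G(z) - (1 - a) G(x) - a G(y)].
    The contraction property and the minimality of a bound the first bracket by
    c |F(x)|.  The second bracket, the affine defect of G, vanishes when G is
    affine; here G need not even be differentiable, and the point is that its
    defect is at most c |a| |x - y| up to an error of lower order.  Indeed Q and
    H are differentiable at the fixed point p and at the projection of Q(p), so
    their own affine defects are negligible ([differentiable_affdefect]).  The defect of the box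
    projection, which acts coordinatewise by clamping, is the difference of two
    numbers lying between 0 and the same number a (y_i - x_i), whence
    [eproj_affdefect] without the factor 2 that two applications of the Lipschitz
    bound would cost.  These facts are combined in [fixmap_affdefect].

    Minimality also says that a (F(x) - F(y)) is the orthogonal projection of
    F(x) on the line through F(x) - F(y), so |a| |F(x) - F(y)| <= |F(x)|, while
    (1 - c) |x - y| <= |F(x) - F(y)|.  Hence the second bracket is at most
    c / (1 - c) |F(x)| plus the error, and c + c / (1 - c) is exactly the
    threshold (2 c - c^2) / (1 - c).

    The error must be small relative to |F(x)| although y can be much farther
    from p than x.  Its natural scale is the quantity
    |1 - a| |x - p| + |a| |y - p| ([spread]): if |F(x)| <= chat |F(y)|, then
    |a| is at most of the order |F(x)| / |F(y)|, so the spread is O(|F(x)|)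
    ([spread_le_residual]). *)

(** * The Euclidean norm *)

Section EuclideanNorm.
Context {R : realType} {n : nat}.
Implicit Types (x y d : 'rV[R]_n) (a : R).

Definition edot x y : R := \sum_(i < n) x ord0 i * y ord0 i.

Lemma edotC x y : edot x y = edot y x.
Proof. by apply: eq_bigr => i _; rewrite mulrC. Qed.

Lemma edotDl x y d : edot (x + y) d = edot x d + edot y d.
Proof. by rewrite -big_split; apply: eq_bigr => i _; rewrite !mxE mulrDl. Qed.

Lemma edotZl a x y : edot (a *: x) y = a * edot x y.
Proof. by rewrite /edot mulr_sumr; apply: eq_bigr => i _; rewrite !mxE mulrA. Qed.

Lemma enorm_ge0 x : 0 <= enorm x.
Proof. exact: sqrtr_ge0. Qed.

Lemma sqr_enorm x : enorm x ^+ 2 = edot x x.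
Proof.
rewrite sqr_sqrtr; last by apply: sumr_ge0 => i _; exact: sqr_ge0.
by apply: eq_bigr => i _; rewrite expr2.
Qed.

Lemma sqr_enormD x y :
  enorm (x + y) ^+ 2 = enorm x ^+ 2 + 2 * edot x y + enorm y ^+ 2.
Proof.
rewrite !sqr_enorm edotDl (edotC x (x + y)) (edotC y (x + y)) !edotDl.
by rewrite (edotC y x); ring.
Qed.

Lemma enormZ a x : enorm (a *: x) = `|a| * enorm x.
Proof.
apply/eqP; rewrite -(@eqrXn2 _ 2%N) ?mulr_ge0 ?enorm_ge0//; apply/eqP.
rewrite exprMn !sqr_enorm edotZl edotC edotZl mulrA.
by rewrite real_normK ?num_real ?expr2.
Qed.

Lemma coordB x y i : (x - y) ord0 i = x ord0 i - y ord0 i.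
Proof. by rewrite !mxE. Qed.

Lemma enorm0 : enorm (0 : 'rV[R]_n) = 0.
Proof. by rewrite -(scale0r 0) enormZ normr0 mul0r. Qed.

Lemma enormN x : enorm (- x) = enorm x.
Proof. by rewrite -scaleN1r enormZ normrN1 mul1r. Qed.

Lemma enormBC x y : enorm (x - y) = enorm (y - x).
Proof. by rewrite -opprB enormN. Qed.

Lemma normr_coord_le_enorm x i : `|x ord0 i| <= enorm x.
Proof.
rewrite -(@ler_pXn2r _ 2%N)// ?nnegrE ?enorm_ge0// real_normK ?num_real//.
rewrite sqr_enorm /edot (bigD1 i)//= -expr2 lerDl.
by apply: sumr_ge0 => j _; rewrite -expr2 sqr_ge0.
Qed.

Lemma enorm_eq0 x : enorm x = 0 -> x = 0.
Proof.
move=> x0; apply/rowP => i; rewrite mxE; apply/eqP; rewrite -normr_le0.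
by rewrite -x0 normr_coord_le_enorm.
Qed.

Lemma enorm_le_coord x y :
  (forall i, `|x ord0 i| <= `|y ord0 i|) -> enorm x <= enorm y.
Proof.
move=> xy; rewrite ler_wsqrtr//; apply: ler_sum => i _.
rewrite -(real_normK (num_real (x _ _))) -(real_normK (num_real (y _ _))).
by rewrite ler_pXn2r ?nnegrE.
Qed.

Lemma edot_le_enorm x y : edot x y <= enorm x * enorm y.
Proof.
have [x0|x0] := eqVneq (enorm x) 0.
  by rewrite (enorm_eq0 _ x0) -(scale0r 0) edotZl enormZ normr0 !mul0r.
have [y0|y0] := eqVneq (enorm y) 0.
  by rewrite (enorm_eq0 _ y0) edotC -(scale0r 0) edotZl enormZ normr0 !(mul0r, mulr0).
have xp : 0 < enorm x by rewrite lt0r x0 enorm_ge0.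
have yp : 0 < enorm y by rewrite lt0r y0 enorm_ge0.
have := sqr_ge0 (enorm (enorm y *: x + (- enorm x) *: y)).
rewrite sqr_enormD !enormZ normrN !ger0_norm ?enorm_ge0// edotZl.
rewrite (edotC x) edotZl (edotC y) => h.
rewrite -subr_ge0 -(pmulr_rge0 _ (mulr_gt0 (mulr_gt0 (ltr0Sn R 1) xp) yp)).
by apply: le_trans h _; rewrite le_eqVlt; apply/orP; left; apply/eqP; ring.
Qed.

Lemma enormD x y : enorm (x + y) <= enorm x + enorm y.
Proof.
rewrite -(@ler_pXn2r _ 2%N)// ?nnegrE ?addr_ge0 ?enorm_ge0//.
by rewrite sqr_enormD sqrrD; have := edot_le_enorm x y; lra.
Qed.

Lemma mx_norm_le_enorm x : `|x| <= enorm x.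
Proof.
rewrite [leLHS]mx_normrE; apply/bigmax_leP; split; first exact: enorm_ge0.
by move=> [i j] _ /=; rewrite (ord1 i) normr_coord_le_enorm.
Qed.

Lemma enorm_le_mx_norm x : enorm x <= Num.sqrt n%:R * `|x|.
Proof.
rewrite -[X in _ * X](ger0_norm (normr_ge0 x)) -sqrtr_sqr -sqrtrM ?ler0n//.
apply: ler_wsqrtr.
have -> : n%:R * `|x| ^+ 2 = \sum_(i < n) `|x| ^+ 2.
  by rewrite sumr_const card_ord mulr_natl.
apply: ler_sum => i _; rewrite -(real_normK (num_real (x _ _))).
rewrite ler_pXn2r ?nnegrE// [leRHS]mx_normrE.
by apply/bigmax_geP; right; exists (ord0, i).
Qed.

End EuclideanNorm.

Lemma open_enorm_ball {R : realType} m (A : set 'rV[R]_m) p : open A -> A p ->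
  exists2 r, 0 < r & forall x, enorm (x - p) <= r -> A x.
Proof.
move=> Ao Ap; have /nbhs_normP[r /= r0 hr] : nbhs p A by exact: open_nbhs_nbhs.
exists (r / 2); first by rewrite divr_gt0.
move=> x xr; apply: hr => /=; rewrite distrC.
by apply: le_lt_trans (mx_norm_le_enorm _) _; lra.
Qed.

(** * Affine combinations and affine defects *)

Section AffineDefect.
Context {R : realType}.

Definition affcomb {n} (a : R) (x y : 'rV[R]_n) : 'rV[R]_n :=
  (1 - a) *: x + a *: y.

Definition affdefect {m n} (f : 'rV[R]_m -> 'rV[R]_n) a x y : 'rV[R]_n :=
  f (affcomb a x y) - affcomb a (f x) (f y).

(** The weighted distance to [p] that controls at once the size of
    [affcomb a x y - p] and the linearization errors at [x] and [y], each with
    the weight with which it enters the defect; it stays small for a large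
    [a] as long as [a] times the distance of [y] to [p] is small. *)
Definition spread {n} (p : 'rV[R]_n) (a : R) (x y : 'rV[R]_n) : R :=
  `|1 - a| * enorm (x - p) + `|a| * enorm (y - p).

Lemma affcombB n a (x y x' y' : 'rV[R]_n) :
  affcomb a x y - affcomb a x' y' = affcomb a (x - x') (y - y').
Proof. by rewrite /affcomb opprD addrACA -!scalerBr. Qed.

Lemma affcombxx n a (x : 'rV[R]_n) : affcomb a x x = x.
Proof. by rewrite /affcomb -scalerDl subrK scale1r. Qed.

Lemma affcombBr n a (x y p : 'rV[R]_n) :
  affcomb a x y - p = affcomb a (x - p) (y - p).
Proof. by rewrite -affcombB affcombxx. Qed.

Lemma enorm_affcombB n (p : 'rV[R]_n) a x y :
  enorm (affcomb a x y - p) <= spread p a x y.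
Proof.
rewrite affcombBr; apply: le_trans (enormD _ _) _.
by rewrite !enormZ.
Qed.

Lemma spread_ge0 n (p : 'rV[R]_n) a x y : 0 <= spread p a x y.
Proof. by rewrite addr_ge0// mulr_ge0// enorm_ge0. Qed.

Lemma spread_lip m n (f : 'rV[R]_m -> 'rV[R]_n) k p a x y :
  enorm (f x - f p) <= k * enorm (x - p) ->
  enorm (f y - f p) <= k * enorm (y - p) ->
  spread (f p) a (f x) (f y) <= k * spread p a x y.
Proof.
by move=> fx fy; rewrite mulrDr; apply: lerD; rewrite mulrCA ler_wpM2l.
Qed.

(** The first-order expansion is available in the sup norm; the factor
    [Num.sqrt n%:R] comparing the two norms is absorbed in [e]. *)
Lemma differentiable_remainder m n (f : 'rV[R]_m -> 'rV[R]_n) p e :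
  differentiable f p -> 0 < e ->
  exists2 r, 0 < r & forall x, enorm (x - p) <= r ->
    enorm (f x - f p - 'd f p (x - p)) <= e * enorm (x - p).
Proof.
move=> /diff_locally /eqaddoP df e0.
pose s := Num.sqrt n%:R : R.
have s0 : 0 < s + 1 by rewrite ltr_wpDl// sqrtr_ge0.
have /nbhs_norm0P[r /= r0 hr] := df _ (divr_gt0 e0 s0).
exists (r / 2); first by rewrite divr_gt0.
move=> x xr; have := hr (x - p); rewrite /= !fctE /= subrK => h.
apply: le_trans (enorm_le_mx_norm _) _.
have {}h : `|f x - f p - 'd f p (x - p)| <= e / (s + 1) * enorm (x - p).
  rewrite -addrA -opprD; apply: le_trans (h _) _.
    apply: le_lt_trans (mx_norm_le_enorm _) _; apply: le_lt_trans xr _; lra.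
  by rewrite ler_wpM2l ?mx_norm_le_enorm// divr_ge0// ltW.
apply: (@le_trans _ _ ((s + 1) * (e / (s + 1) * enorm (x - p)))).
  by apply: ler_pM => //; rewrite ?sqrtr_ge0// lerDl.
by rewrite mulrA [_ * (e / _)]mulrC divfK// gt_eqF.
Qed.

(** The affine part of the expansion of [f] at [p] has no defect, so the defect
    of [f] is that of the remainder, whose three terms are each small against
    the spread. *)
Lemma differentiable_affdefect m n (f : 'rV[R]_m -> 'rV[R]_n) p e :
  differentiable f p -> 0 < e ->
  exists2 r, 0 < r & forall a x y,
    enorm (x - p) <= r -> enorm (y - p) <= r -> spread p a x y <= r ->
    enorm (affdefect f a x y) <= e * spread p a x y.
Proof.
move=> df e0; have e20 : 0 < e / 2 by rewrite divr_gt0.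
have [r r0 hr] := differentiable_remainder _ _ _ _ _ df e20.
exists r => // a x y xr yr zr.
pose rem x := f x - f p - 'd f p (x - p).
have -> : affdefect f a x y = rem (affcomb a x y) - affcomb a (rem x) (rem y).
  rewrite /rem -affcombB -affcombB affcombxx.
  have -> : 'd f p (affcomb a x y - p) = affcomb a ('d f p (x - p)) ('d f p (y - p)).
    by rewrite affcombBr linearD !linearZ.
  by rewrite opprB addrA subrK opprB addrA subrK.
apply: le_trans (enormD _ _) _; rewrite enormN.
have := hr _ (le_trans (enorm_affcombB _ p a x y) zr).
have /(ler_wpM2l (ltW e20)) := enorm_affcombB _ p a x y.
have := enormD ((1 - a) *: rem x) (a *: rem y); rewrite -/(affcomb _ _ _) !enormZ.
have := ler_wpM2l (normr_ge0 (1 - a)) (hr _ xr).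
have := ler_wpM2l (normr_ge0 a) (hr _ yr).
by rewrite /spread -/(rem _) -/(rem _) -/(rem _); lra.
Qed.

End AffineDefect.

(** * The projection onto a box *)

Section BoxProjection.
Context {R : realType}.

Definition clamp (a b : \bar R) (x : R) : R :=
  if (x%:E < a)%E then fine a else if (b < x%:E)%E then fine b else x.

Lemma clamp_itv a b x :
  (a < b)%E -> ((a <= (clamp a b x)%:E) /\ ((clamp a b x)%:E <= b))%E.
Proof.
rewrite /clamp; case: (ltP x%:E a) => xa; last case: (ltP b x%:E) => bx.
- by case: a xa => [a|_|//]; [move=> _ ab; split => //; exact: ltW|case: b].
- by case: b bx => [b| |//]; [move=> _ ab; split => //; exact: ltW|case: a xa|case: a xa].
- by [].
Qed.

(** The variational inequality that characterizes a projection. *)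
Lemma clamp_obtuse a b x v :
  (a <= v%:E)%E -> (v%:E <= b)%E -> (v - clamp a b x) * (x - clamp a b x) <= 0.
Proof.
rewrite /clamp; case: (ltP x%:E a) => xa; last case: (ltP b x%:E) => bx.
- case: a xa => [a| |//]; last by [].
  by rewrite lte_fin lee_fin /= => xa av _; nra.
- case: b bx => [b| |]; [|by []|by []].
  by rewrite lte_fin lee_fin /= => bx _ vb; nra.
- by rewrite subrr mulr0.
Qed.

(** Firm nonexpansiveness, obtained by adding the variational inequalities at
    the two points.  On the line it says that the increment of [clamp] lies
    between 0 and the increment of its argument. *)
Lemma clamp_firm a b x y : (a < b)%E ->
  (clamp a b x - clamp a b y) ^+ 2 <= (clamp a b x - clamp a b y) * (x - y).
Proof.
move=> ab; have [px qx] := clamp_itv a b x ab; have [py qy] := clamp_itv a b y ab.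
have := clamp_obtuse a b x _ py qy; have := clamp_obtuse a b y _ px qx.
by move: (clamp a b x) (clamp a b y) => p q; nra.
Qed.

Lemma firm_itv (s t : R) :
  t ^+ 2 <= t * s -> 0 <= t <= s \/ s <= t <= 0.
Proof.
move=> h; have [s0|s0] := leP 0 s; [left|right]; apply/andP; split; nra.
Qed.

Lemma normB_firm (s t t' : R) :
  t ^+ 2 <= t * s -> t' ^+ 2 <= t' * s -> `|t - t'| <= `|s|.
Proof.
move=> /firm_itv ht /firm_itv ht'.
have [s0|s0] := leP 0 s; first by rewrite (ger0_norm s0) ler_norml; lra.
by rewrite (ltr0_norm s0) ler_norml; lra.
Qed.

Section Eproj.
Context {l : nat} {lo hi : 'I_l -> \bar R}.
Hypothesis lo_lt_hi : forall i, (lo i < hi i)%E.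

Lemma eproj_boxE w :
  eproj (box lo hi) w = \row_i clamp (lo i) (hi i) (w ord0 i).
Proof.
set q := \row_i _.
have qE i : q ord0 i = clamp (lo i) (hi i) (w ord0 i) by rewrite mxE.
have qbox : box lo hi q by move=> i; rewrite qE; exact: clamp_itv.
apply: xget_unique.
  split=> // v vbox; apply: enorm_le_coord => i; rewrite !coordB qE.
  have [lv vh] := vbox i; have := clamp_obtuse _ _ (w ord0 i) _ lv vh.
  rewrite -[`|_| <= _](@ler_pXn2r _ 2%N) ?nnegrE// !real_normK ?num_real//.
  by move: (clamp _ _ _) => p; have := sqr_ge0 (v ord0 i - p); lra.
move=> y [ybox ymin]; apply/eqP; rewrite eq_sym -subr_eq0; apply/eqP.
apply: enorm_eq0; apply/eqP; rewrite -sqrf_eq0 eq_le sqr_ge0 andbT.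
have obt : 0 <= edot (w - q) (q - y).
  apply: sumr_ge0 => i _; rewrite !coordB qE.
  have [ly yh] := ybox i; have := clamp_obtuse _ _ (w ord0 i) _ ly yh.
  by move: (clamp _ _ _) => p; lra.
have := ymin _ qbox; rewrite -(@ler_pXn2r _ 2%N) ?nnegrE ?enorm_ge0//.
have -> : w - y = (w - q) + (q - y) by rewrite addrA subrK.
by rewrite sqr_enormD; lra.
Qed.

Lemma box_eproj w : box lo hi (eproj (box lo hi) w).
Proof. by rewrite eproj_boxE => i; rewrite mxE; exact: clamp_itv. Qed.

Lemma eproj_nonexpansive w w' :
  enorm (eproj (box lo hi) w - eproj (box lo hi) w') <= enorm (w - w').
Proof.
apply: enorm_le_coord => i; rewrite !eproj_boxE !mxE.
rewrite -[X in `|X| <= _]subr0; apply: normB_firm; first exact: clamp_firm.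
by rewrite expr0n mul0r.
Qed.

(** If [x] and [y] are the coordinates of [w] and [w'] at some index and
    [s = a * (y - x)], the corresponding coordinate of the defect is the difference of
    the increment of [clamp] along [s] and [a] times its increment from [x] to
    [y]; both lie between 0 and [s], so their difference is at most [`|s|]. *)
Lemma eproj_affdefect a w w' :
  enorm (affdefect (eproj (box lo hi)) a w w') <= `|a| * enorm (w - w').
Proof.
rewrite -enormZ; apply: enorm_le_coord => i; rewrite /affdefect /affcomb.
rewrite !eproj_boxE !mxE; set f := clamp _ _.
set x := w _ _; set y := w' _ _.
have -> : f ((1 - a) * x + a * y) - ((1 - a) * f x + a * f y) =
  (f ((1 - a) * x + a * y) - f x) - a * (f y - f x) by ring.
have fx : (f ((1 - a) * x + a * y) - f x) ^+ 2 <=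
    (f ((1 - a) * x + a * y) - f x) * (a * (y - x)).
  have := clamp_firm _ _ ((1 - a) * x + a * y) x (lo_lt_hi i).
  by have -> : (1 - a) * x + a * y - x = a * (y - x) by ring.
have fy : (a * (f y - f x)) ^+ 2 <= a * (f y - f x) * (a * (y - x)).
  have := ler_wpM2l (sqr_ge0 a) (clamp_firm _ _ y x (lo_lt_hi i)).
  by rewrite -![clamp _ _ _]/(f _); move: (f x) (f y) => p q; lra.
by apply: le_trans (normB_firm _ _ _ fx fy) _; rewrite !normrM distrC.
Qed.

End Eproj.
End BoxProjection.

(** * The affine defect of the fixed point map *)

Section Composite.
Context {R : realType} {n l : nat} {lo hi : 'I_l -> \bar R}
  {Q : 'rV[R]_n -> 'rV[R]_l} {H : 'rV[R]_l -> 'rV[R]_n}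
  {D : set 'rV[R]_n} {DH : set 'rV[R]_l} {cQ cH : R}.
Hypothesis lo_lt_hi : forall i, (lo i < hi i)%E.
Hypothesis box_DH : box lo hi `<=` DH.
Hypothesis Q_lip : elipschitz_on cQ D Q.
Hypothesis H_lip : elipschitz_on cH DH H.

Lemma fixmap_lip : elipschitz_on (cH * cQ) D (fixmap lo hi Q H).
Proof.
have [cQ0 Ql] := Q_lip; have [cH0 Hl] := H_lip.
split=> [|x y Dx Dy]; first exact: mulr_ge0.
have DHP w : DH (eproj (box lo hi) w) by exact/box_DH/box_eproj.
apply: le_trans (Hl _ _ (DHP _) (DHP _)) _.
rewrite -mulrA ler_wpM2l//.
by apply: le_trans (eproj_nonexpansive lo_lt_hi _ _) _; exact: Ql.
Qed.

(** The defect of the composition is propagated through [Q], the projection and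
    [H].  The projection of the combination of [Q x] and [Q y] is compared with
    the combination of the projections: this is the only contribution that
    is not negligible, and it costs [cQ] through [Q] and [cH] through [H]. *)
Lemma fixmap_affdefect p e : open DH -> D p ->
  differentiable Q p -> differentiable H (eproj (box lo hi) (Q p)) -> 0 < e ->
  exists2 r, 0 < r & forall a x y, D x -> D y -> D (affcomb a x y) ->
    enorm (x - p) <= r -> enorm (y - p) <= r -> spread p a x y <= r ->
    enorm (affdefect (fixmap lo hi Q H) a x y)
      <= cH * cQ * (`|a| * enorm (x - y)) + e * spread p a x y.
Proof.
move=> DHo Dp dQ dH e0; have [cQ0 Ql] := Q_lip; have [cH0 Hl] := H_lip.
pose P := eproj (box lo hi); pose S x := P (Q x).
have Slip x y : D x -> D y -> enorm (S x - S y) <= cQ * enorm (x - y).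
  by move=> Dx Dy; apply: le_trans (eproj_nonexpansive lo_lt_hi _ _) (Ql _ _ Dx Dy).
(* The error [e'] enters through [Q] with the factor [cH] and through [H] with
   the factor [cQ]; the additional 1 keeps the divisor positive. *)
have k0 : 0 < cH + cQ + 1 by lra.
have e1 : 0 < e / (cH + cQ + 1) by exact: divr_gt0.
set e' := e / _ in e1.
have ee' : e = e' * (cH + cQ + 1) by rewrite divfK// gt_eqF.
have [rQ rQ0 hQ] := differentiable_affdefect _ _ _ _ _ dQ e1.
have [rH rH0 hH] := differentiable_affdefect _ _ _ _ _ dH e1.
have [rD rD0 hD] := open_enorm_ball _ _ _ DHo (box_DH _ (box_eproj lo_lt_hi (Q p))).
pose r' := Num.min rH rD / (cQ + 1).
have cQ1 : 0 < cQ + 1 by lra.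
exists (Num.min rQ r'); first by rewrite lt_min rQ0 divr_gt0// lt_min rH0.
have scale t : t <= Num.min rQ r' -> 0 <= t ->
    [/\ t <= rQ, cQ * t <= rH & cQ * t <= rD].
  rewrite le_min ler_pdivlMr// le_min => /and3P[tQ tH tD] t0.
  by split=> //; lra.
move=> a x y Dx Dy Dz xr yr zr.
have [xQ xH _] := scale _ xr (enorm_ge0 _).
have [yQ yH _] := scale _ yr (enorm_ge0 _).
have [zQ zH zD] := scale _ zr (spread_ge0 _ _ _ _ _).
have sprS : spread (S p) a (S x) (S y) <= cQ * spread p a x y.
  by apply: spread_lip; exact: Slip.
have DHS u : DH (S u) by exact/box_DH/box_eproj.
(* The combination may leave the box, so [H] is evaluated there only thanks to
   the openness of [DH]. *)
have DHc : DH (affcomb a (S x) (S y)).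
  by apply: hD; apply: le_trans (enorm_affcombB _ _ _ _ _) (le_trans sprS zD).
have -> : affdefect (fixmap lo hi Q H) a x y =
    (H (S (affcomb a x y)) - H (affcomb a (S x) (S y)))
    + affdefect H a (S x) (S y) by rewrite /affdefect addrA subrK.
apply: le_trans (enormD _ _) _.
have hHd := hH a _ _ (le_trans (Slip _ _ Dx Dp) xH)
  (le_trans (Slip _ _ Dy Dp) yH) (le_trans sprS zH).
have hS : enorm (S (affcomb a x y) - affcomb a (S x) (S y)) <=
    e' * spread p a x y + `|a| * (cQ * enorm (x - y)).
  have -> : S (affcomb a x y) - affcomb a (S x) (S y) =
      (P (Q (affcomb a x y)) - P (affcomb a (Q x) (Q y)))
      + affdefect P a (Q x) (Q y) by rewrite /affdefect addrA subrK.
  apply: le_trans (enormD _ _) _; apply: lerD.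
    by apply: le_trans (eproj_nonexpansive lo_lt_hi _ _) (hQ _ _ _ xQ yQ zQ).
  apply: le_trans (eproj_affdefect lo_lt_hi _ _ _) _.
  by rewrite ler_wpM2l//; exact: Ql.
have := Hl _ _ (DHS (affcomb a x y)) DHc.
have := ler_wpM2l cH0 hS; have := ler_wpM2l (ltW e1) sprS.
have := mulr_ge0 (ltW e1) (spread_ge0 _ p a x y).
rewrite ee'; lra.
Qed.
End Composite.

(** * The Anderson step *)

Section Minimizer.
Context {R : realType} {n : nat}.

(** At the minimum the combination is orthogonal to [f - g], so Pythagoras gives
    [enorm f ^+ 2] as the sum of the squares of the two left-hand sides. *)
Lemma affcomb_min_le (f g : 'rV[R]_n) a :
  (forall b, enorm (affcomb a f g) <= enorm (affcomb b f g)) ->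
  enorm (affcomb a f g) <= enorm f /\ `|a| * enorm (f - g) <= enorm f.
Proof.
move=> amin; split.
  by apply: le_trans (amin 0) _; rewrite /affcomb subr0 scale1r scale0r addr0.
have [d0|d0] := eqVneq (enorm (f - g)) 0; first by rewrite d0 mulr0 enorm_ge0.
have d2 : 0 < enorm (f - g) ^+ 2 by rewrite exprn_even_gt0.
have shift b t : affcomb (b + t) f g = affcomb b f g + (- t) *: (f - g).
  by apply/rowP => i; rewrite !mxE; ring.
(* Perturbing [a] by the minimizer [t] of the resulting quadratic would
   decrease the norm unless the inner product is 0. *)
have orth : edot (affcomb a f g) (f - g) = 0.
  set s := edot _ _; pose t := s / enorm (f - g) ^+ 2.
  have tE : s = t * enorm (f - g) ^+ 2 by rewrite divfK// gt_eqF.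
  have := amin (a + t); rewrite -(@ler_pXn2r _ 2%N) ?nnegrE ?enorm_ge0//.
  rewrite shift [in leRHS]sqr_enormD [edot _ (- t *: _)]edotC edotZl.
  rewrite [edot (f - g) _]edotC -/s enormZ normrN exprMn real_normK ?num_real//.
  rewrite tE => h.
  have : t ^+ 2 * enorm (f - g) ^+ 2 <= 0 by lra.
  by rewrite pmulr_lle0// => t2; rewrite (_ : t = 0) ?mul0r//; nra.
have := shift 0 0; have := shift a (- a).
rewrite addrN opprK {1}/affcomb subr0 scale1r scale0r addr0 => fE _.
rewrite -(@ler_pXn2r _ 2%N) ?nnegrE ?mulr_ge0 ?enorm_ge0// -enormZ.
rewrite [X in _ <= enorm X ^+ 2]fE sqr_enormD [edot _ (_ *: _)]edotC edotZl.
rewrite [edot (f - g) _]edotC orth.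
by have := sqr_ge0 (enorm (affcomb a f g)); lra.
Qed.
End Minimizer.

Section LocalStep.
Context {R : realType} {n : nat} {G : 'rV[R]_n -> 'rV[R]_n}
  {D : set 'rV[R]_n} {c : R} {p : 'rV[R]_n}.
Hypothesis G_lip : elipschitz_on c D G.
Hypothesis c_lt1 : c < 1.
Hypothesis Dp : D p.
Hypothesis Gp : G p = p.

Lemma residual_expansive x y : D x -> D y ->
  (1 - c) * enorm (x - y) <= enorm (residual G x - residual G y).
Proof.
move=> Dx Dy; have [_ /(_ x y Dx Dy)] := G_lip.
have : x - y = (G x - G y) - (residual G x - residual G y).
  by apply/rowP => i; rewrite !mxE; ring.
have := enormD (G x - G y) (- (residual G x - residual G y)).
by rewrite enormN => h1 h2; rewrite -h2 in h1; lra.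
Qed.

Lemma residual_fix : residual G p = 0.
Proof. by rewrite /residual Gp subrr. Qed.

Lemma dist_le_residual x : D x ->
  (1 - c) * enorm (x - p) <= enorm (residual G x).
Proof.
move=> Dx; have := residual_expansive _ _ Dx Dp.
by rewrite residual_fix subr0.
Qed.

Lemma residual_le_dist x : D x ->
  enorm (residual G x) <= (1 + c) * enorm (x - p).
Proof.
move=> Dx; have [_ /(_ x p Dx Dp)] := G_lip; rewrite Gp.
have -> : residual G x = (G x - p) - (x - p) by rewrite opprB addrA subrK.
by have := enormD (G x - p) (- (x - p)); rewrite enormN; lra.
Qed.

Lemma residual_step_le x : D x -> D (G x) ->
  enorm (residual G (G x)) <= c * enorm (residual G x).
Proof. by move=> Dx DGx; have [_ h] := G_lip; exact: h. Qed.

(** The decrease [ch] from [y] to [x] separates the two residuals, so that [`|a|]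
    times the residual at [y], a fortiori at [x], is at most
    [enorm (residual G x) / (1 - ch)]; distances to [p] are residuals up to the
    factor [1 - c].  The bound [`|1 - a| <= 1 + `|a|] gives the 2. *)
Lemma spread_le_residual ch a x y : D x -> D y -> ch < 1 ->
  enorm (residual G x) <= ch * enorm (residual G y) ->
  `|a| * enorm (residual G x - residual G y) <= enorm (residual G x) ->
  spread p a x y <= (1 + 2 / (1 - ch)) / (1 - c) * enorm (residual G x).
Proof.
move=> Dx Dy ch1 Fxy aF; set s := enorm (residual G x) in Fxy aF *.
set t := enorm (residual G y) in Fxy.
have c1 : 0 < 1 - c by rewrite subr_gt0.
have k1 : 0 < 1 - ch by rewrite subr_gt0.
have s0 : 0 <= s by exact: enorm_ge0.
have t0 : 0 <= t by exact: enorm_ge0.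
have ts : (1 - ch) * t <= enorm (residual G x - residual G y).
  have := enormD (residual G x - residual G y) (- residual G x).
  by rewrite enormN addrAC subrr sub0r enormN -/s -/t; lra.
have at_s : (1 - ch) * (`|a| * t) <= s.
  by apply: le_trans aF; rewrite mulrCA ler_wpM2l.
have a0 := normr_ge0 a.
have dx := dist_le_residual _ Dx; have dy := dist_le_residual _ Dy.
have atq : `|a| * t <= s / (1 - ch) by rewrite ler_pdivlMr// mulrC.
have st : s <= t by nra.
rewrite mulrAC ler_pdivlMr// mulrC /spread.
have a1 : `|1 - a| <= 1 + `|a|.
  by apply: le_trans (ler_normB _ _) _; rewrite normr1.
have := ler_pM (normr_ge0 _) (mulr_ge0 (ltW c1) (enorm_ge0 _)) a1 dx.
have := ler_wpM2l a0 dy; have := ler_wpM2l a0 st.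
rewrite -/s -/t; lra.
Qed.

(** The new point differs from [affcomb a x y] by the combined residual, which
    the choice of [a] makes at most [enorm (residual G x)]: this gives the
    term [c]; the defect of [G] gives [c / (1 - c)] and the error. *)
Lemma anderson_step ch e a x y : D x -> D y -> D (affcomb a x y) ->
  D (affcomb a (G x) (G y)) -> 0 < e -> ch < 1 ->
  enorm (residual G x) <= ch * enorm (residual G y) ->
  (forall b, enorm (affcomb a (residual G x) (residual G y))
          <= enorm (affcomb b (residual G x) (residual G y))) ->
  enorm (affdefect G a x y)
    <= c * (`|a| * enorm (x - y)) + e * spread p a x y ->
  enorm (residual G (affcomb a (G x) (G y)))
    <= (c + c / (1 - c) + e * ((1 + 2 / (1 - ch)) / (1 - c)))
       * enorm (residual G x).
Proof.
move=> Dx Dy Dz Dz' e0 ch1 Fxy /(affcomb_min_le _ _ _)[Fa aF] dG.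
have c1 : 0 < 1 - c by rewrite subr_gt0.
have [c0 Gl] := G_lip.
have spr := spread_le_residual _ _ _ _ Dx Dy ch1 Fxy aF.
have axy : `|a| * enorm (x - y) <= enorm (residual G x) / (1 - c).
  rewrite ler_pdivlMr// -mulrA [enorm _ * _]mulrC; apply: le_trans aF.
  by rewrite ler_wpM2l// residual_expansive.
have FaE : affcomb a (residual G x) (residual G y) =
    affcomb a (G x) (G y) - affcomb a x y by rewrite affcombB.
have := Gl _ _ Dz' Dz; rewrite -FaE => hG.
have -> : residual G (affcomb a (G x) (G y)) =
    (G (affcomb a (G x) (G y)) - G (affcomb a x y)) + affdefect G a x y.
  by rewrite /affdefect addrA subrK.
apply: le_trans (enormD _ _) _.
have := ler_wpM2l c0 Fa; have := ler_wpM2l c0 axy; have := ler_wpM2l (ltW e0) spr.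
lra.
Qed.
End LocalStep.

(** * Local q-linear convergence *)

Lemma cvg_enorm_geometric (R : realType) n (u : nat -> 'rV[R]_n) p C q :
  0 <= q < 1 -> (forall k, enorm (u k - p) <= C * q ^+ k) -> u @ \oo --> p.
Proof.
move=> /andP[q0 q1] hu.
have /cvgr0_norm_le g0 : geometric C q @ \oo --> 0.
  by apply: cvg_geometric; rewrite ger0_norm.
apply/cvgrPdist_le => e e0; have := g0 _ e0; apply: filterS => k /= hk.
rewrite distrC; apply: le_trans (mx_norm_le_enorm _) _.
by apply: le_trans (hu k) (le_trans (ler_norm _) hk).
Qed.

Theorem theorem2p1 (R : realType) (n l : nat)
    (lo hi : 'I_l -> \bar R)
    (Q : 'rV[R]_n -> 'rV[R]_l) (H : 'rV[R]_l -> 'rV[R]_n)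
    (D : set 'rV[R]_n) (DH : set 'rV[R]_l)
    (cQ cH delta : R) (ustar : 'rV[R]_n)
    (lo_lt_hi : forall i, (lo i < hi i)%E)
    (D_closed : closed D)
    (G_D : forall u, D u -> D (fixmap lo hi Q H u))
    (Q_C1 : C1_lipschitz_on D Q)
    (Q_lip : elipschitz_on cQ D Q)
    (DH_open : open DH)
    (box_DH : box lo hi `<=` DH)
    (H_C1 : C1_lipschitz_on DH H)
    (H_lip : elipschitz_on cH DH H)
    (c_lt1 : cH * cQ < 1)
    (D_ustar : D ustar)
    (fix_ustar : fixmap lo hi Q H ustar = ustar)
    (delta_gt0 : 0 < delta)
    (ball_D : [set u | enorm (u - ustar) <= delta] `<=` D) :
  let G := fixmap lo hi Q H in
  let c := cH * cQ in
  let cbar := (2 * c - c ^+ 2) / (1 - c) in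
  cbar < 1 ->
  forall chat : R, cbar < chat -> chat < 1 ->
  exists delta0 : R, 0 < delta0 /\
    forall (u0 : 'rV[R]_n) (u : nat -> 'rV[R]_n),
      D u0 -> enorm (u0 - ustar) <= delta0 ->
      anderson1 G u0 u ->
      (u @ \oo --> ustar) /\
      forall k : nat,
        enorm (residual G (u k.+1)) <= chat * enorm (residual G (u k)).
Proof.
move=> G c cbar cbar1 ch cbar_ch ch1.
have [cQ0 _] := Q_lip; have [cH0 _] := H_lip.
have c0 : 0 <= c by exact: mulr_ge0.
have c1 : 0 < 1 - c by rewrite subr_gt0.
have G_lip : elipschitz_on c D G by exact: fixmap_lip lo_lt_hi box_DH Q_lip H_lip.
have cbarE : cbar = c + c / (1 - c).
  by rewrite /cbar; field; rewrite gt_eqF.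
have cq0 : 0 <= c / (1 - c) by rewrite divr_ge0// ltW.
have c_ch : c <= ch by lra.
have ch0 : 0 <= ch by lra.
(* [K] bounds the spread by the residual, and [e] spends on the error exactly
   the gap between [cbar] and [ch]. *)
pose K := (1 + 2 / (1 - ch)) / (1 - c).
have K1 : 1 <= K * (1 - c).
  by rewrite divfK ?gt_eqF// lerDl divr_ge0// subr_ge0 ltW.
have K0 : 0 < K by rewrite -(pmulr_lgt0 _ c1); lra.
pose e := (ch - cbar) / K.
have e0 : 0 < e by rewrite divr_gt0// subr_gt0.
have [dQ _ _] := Q_C1; have [dH _ _] := H_C1.
have [r1 r10 hdef] := fixmap_affdefect lo_lt_hi box_DH Q_lip H_lip ustar e DH_open
  D_ustar (dQ _ D_ustar) (dH _ (box_DH _ (box_eproj lo_lt_hi _))) e0.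
(* A new iterate is at distance at most [K + 1] times the last residual from
   [ustar]: [K] for the combination of the two points, 1 for that of their
   residuals. *)
pose r := Num.min r1 delta / (K + 1).
have K1p : 0 < K + 1 by lra.
have r0 : 0 < r by rewrite divr_gt0// lt_min r10.
have /andP[rr1 rdelta] : (r * (K + 1) <= r1) && (r * (K + 1) <= delta).
  by rewrite -le_min divfK// gt_eqF.
(* The residual at [u0] is at most [1 + c < 2] times the distance to [ustar]. *)
exists (r / 2); split=> [|u0 u Du0 u0r [u0E u1E uS]]; first by rewrite divr_gt0.
pose F k := enorm (residual G (u k)).
have inv k : [/\ D (u k), D (u k.+1), F k <= r & F k.+1 <= ch * F k].
  elim: k => [|k [Dy Dx Fy Fxy]].
    rewrite /F u1E u0E; have DG := G_D _ Du0; split=> //.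
      have := residual_le_dist G_lip D_ustar fix_ustar _ Du0.
      have := enorm_ge0 (u0 - ustar); rewrite -/c in c_lt1 *; nra.
    apply: le_trans (residual_step_le G_lip _ Du0 DG) _.
    by rewrite ler_wpM2r ?enorm_ge0.
  have [a [amin uE]] := uS k.
  have Fy0 : 0 <= F k by exact: enorm_ge0.
  have Fx0 : 0 <= F k.+1 by exact: enorm_ge0.
  have Fx : F k.+1 <= r by nra.
  have [Fa aF] := affcomb_min_le _ _ _ amin.
  have spr : spread ustar a (u k.+1) (u k) <= K * F k.+1.
    exact: (spread_le_residual G_lip c_lt1 D_ustar fix_ustar _ _ _ _
      Dx Dy ch1 Fxy aF).
  have near z : D z -> enorm (residual G z) <= r -> enorm (z - ustar) <= r1.
    move=> Dz Fz; have := dist_le_residual G_lip D_ustar fix_ustar _ Dz.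
    have := enorm_ge0 (z - ustar); nra.
  have KF : K * F k.+1 <= K * r by rewrite ler_pM2l.
  have Dz : D (affcomb a (u k.+1) (u k)).
    by apply: ball_D; apply: le_trans (enorm_affcombB _ _ _ _ _) _; lra.
  have Dz' : D (u k.+2).
    rewrite uE -/(affcomb _ _ _); apply: ball_D => /=.
    have -> : affcomb a (G (u k.+1)) (G (u k)) - ustar =
       affcomb a (residual G (u k.+1)) (residual G (u k))
       + (affcomb a (u k.+1) (u k) - ustar).
      by rewrite -affcombB addrA subrK.
    apply: le_trans (enormD _ _) _.
    have := enorm_affcombB _ ustar a (u k.+1) (u k).
    move: Fa; rewrite -/(F _); lra.
  split=> //.
  have sr1 : spread ustar a (u k.+1) (u k) <= r1 by lra.
  have dG := hdef a _ _ Dx Dy Dz (near _ Dx Fx) (near _ Dy Fy) sr1.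
  have := anderson_step G_lip c_lt1 D_ustar fix_ustar _ _ _ _ _ Dx Dy Dz _
    e0 ch1 Fxy amin dG.
  rewrite -/(affcomb a (G (u k.+1)) (G (u k))) in uE.
  rewrite -uE -/K divfK ?gt_eqF// -cbarE [cbar + _]addrC subrK; exact.
have Fq k : F k <= F 0%N * ch ^+ k.
  elim: k => [|k IH]; first by rewrite expr0 mulr1.
  have [_ _ _ hk] := inv k; apply: le_trans hk _.
  by rewrite exprS mulrCA ler_wpM2l.
split=> [|k]; last by have [] := inv k.
apply: (@cvg_enorm_geometric _ _ _ _ (F 0%N / (1 - c)) ch); first by rewrite ch0.
move=> k; have [Dk _ _ _] := inv k.
have := dist_le_residual G_lip D_ustar fix_ustar _ Dk; rewrite -/(F k) => hk.
rewrite mulrAC ler_pdivlMr// mulrC; exact: le_trans hk (Fq k).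
Qed.
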